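(* Let $X_1,X_2,Y$ be real Banach spaces, let $X=X_1\oplus_1 X_2$, let $T: X\to Y$ be a bounded linear operator, and let $T_1: X_1\to Y$, $T_1x_1=T(x_1,0)$, and $T_2: X_2\to Y$, $T_2x_2=T(0,x_2)$, be its restrictions. If $T_1$ is a narrow operator on $X_1$ and $T_2$ is a narrow operator on $X_2$, then $T$ is a narrow operator on $X$.
   Context: All Banach spaces are real; $S(X)$ denotes the unit sphere of $X$. $X_1\oplus_1 X_2$ is the direct sum with norm $\|(x_1,x_2)\|=\|x_1\|+\|x_2\|$. A bounded linear operator $T$ from a Banach space $X$ to some Banach space $Y$ is called a narrow operator (on $X$) if for all $x,y\in S(X)$, every $x^*\in X^*$ and every $\varepsilon>0$ there is $z\in S(X)$ with $\|x+z\|\ge 2-\varepsilon$ and $\|T(y-z)\|+|x^*(y-z)|\le\varepsilon$. *)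

(* Defs.v *)
From HB Require Import structures.
From mathcomp Require Import all_boot all_order all_algebra.
From mathcomp Require Import all_classical all_reals all_analysis.

Set Implicit Arguments.
Unset Strict Implicit.
Unset Printing Implicit Defensive.

Import Order.TTheory GRing.Theory Num.Theory.
Import numFieldNormedType.Exports.

Local Open Scope classical_set_scope.
Local Open Scope ring_scope.

(* The library equips V * W with the max norm. l1sum V W is an alias of V * W
   which keeps its module structure but carries the norm `|x.1| + `|x.2|, and
   the topology and uniformity induced by that norm. *)
Definition l1sum (R : realType) (V W : normedModType R) : Type := (V * W)%type.

Section l1sum_normed.
Context {R : realType} {V W : normedModType R}.

HB.instance Definition _ := GRing.Lmodule.copy (l1sum V W) (V * W)%type.

Let l1norm (x : l1sum V W) : R := `|x.1| + `|x.2|.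

Let l1norm_triangle (x y : l1sum V W) : l1norm (x + y) <= l1norm x + l1norm y.
Proof. by rewrite /l1norm addrACA lerD// ler_normD. Qed.

Let l1normZ (a : R) (x : l1sum V W) : l1norm (a *: x) = `|a| * l1norm x.
Proof. by rewrite /l1norm mulrDr -!normrZ. Qed.

Let l1norm_eq0 (x : l1sum V W) : l1norm x = 0 -> x = 0.
Proof.
case: x => x1 x2 /eqP; rewrite /l1norm/= paddr_eq0// !normr_eq0.
by case/andP=> /eqP-> /eqP->.
Qed.

HB.instance Definition _ := Lmodule_isNormed.Build R (l1sum V W)
  l1norm_triangle l1normZ l1norm_eq0.

Lemma l1sum_normE (x : l1sum V W) : `|x| = `|x.1| + `|x.2|.
Proof. by []. Qed.

Definition l1inl (x : V) : l1sum V W := (x, 0).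
Definition l1inr (y : W) : l1sum V W := (0, y).

Let l1inl_linear : linear l1inl.
Proof. by move=> a x y; congr pair; rewrite /= scaler0 addr0. Qed.

Let l1inr_linear : linear l1inr.
Proof. by move=> a x y; congr pair; rewrite /= scaler0 addr0. Qed.

HB.instance Definition _ :=
  GRing.isLinear.Build R V (l1sum V W) _ l1inl l1inl_linear.
HB.instance Definition _ :=
  GRing.isLinear.Build R W (l1sum V W) _ l1inr l1inr_linear.

End l1sum_normed.

Section l1sum_complete.
Context {R : realType} {V W : completeNormedModType R}.

Let l1sum_cauchy_cvg (F : set_system (l1sum V W)) :
  ProperFilter F -> cauchy F -> cvg F.
Proof.
move=> FF Fc.
have c1 : cauchy ((fun x : l1sum V W => x.1) @ F).
  apply: cauchy_exP => e e0.
  have [x Fx] := (cauchyP _).1 Fc e e0; exists x.1.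
  apply: (@filterS _ F) Fx => y; rewrite -!ball_normE /=.
  by apply: le_lt_trans; rewrite l1sum_normE lerDl.
have c2 : cauchy ((fun x : l1sum V W => x.2) @ F).
  apply: cauchy_exP => e e0.
  have [x Fx] := (cauchyP _).1 Fc e e0; exists x.2.
  apply: (@filterS _ F) Fx => y; rewrite -!ball_normE /=.
  by apply: le_lt_trans; rewrite l1sum_normE lerDr.
have /cvg_ex[l1 l1P] : cvg ((fun x : l1sum V W => x.1) @ F).
  exact: cauchy_cvg.
have /cvg_ex[l2 l2P] : cvg ((fun x : l1sum V W => x.2) @ F).
  exact: cauchy_cvg.
apply/cvg_ex; exists ((l1, l2) : l1sum V W).
apply/cvgrPdist_lt => e e0; rewrite (splitr e).
have e20 : 0 < e / 2 by rewrite divr_gt0.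
move/cvgrPdist_lt: l1P => /(_ _ e20) h1.
move/cvgrPdist_lt: l2P => /(_ _ e20) h2.
near=> x; rewrite l1sum_normE ltrD//; near: x; [exact: h1|exact: h2].
Unshelve. all: by end_near. Qed.

HB.instance Definition _ := Uniform_isComplete.Build (l1sum V W)
  l1sum_cauchy_cvg.

End l1sum_complete.

(* By linear_boundedP: `|f x| <= r * `|x| for all x, for every large enough r. *)
Definition bounded_linear (R : realType) (V W : normedModType R)
  (f : {linear V -> W}) : Prop := bounded_near f (nbhs (0 : V)).

Definition narrow_operator (R : realType) (X Y : completeNormedModType R)
    (T : {linear X -> Y}) : Prop :=
  bounded_linear T /\
  forall x y : X, `|x| = 1 -> `|y| = 1 ->
  forall xs : {linear X -> R^o}, bounded_linear xs ->
  forall e : R, 0 < e ->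
  exists z : X, [/\ `|z| = 1, 2 - e <= `|x + z| &
    `|T (y - z)| + `|xs (y - z)| <= e].

(* Main.v *)
Require Import Defs.
From HB Require Import structures.
From mathcomp Require Import all_boot all_order all_algebra.
From mathcomp Require Import all_classical all_reals all_analysis.
From mathcomp Require Import lra.
Import Order.TTheory GRing.Theory Num.Theory.
Import numFieldNormedType.Exports.
Local Open Scope ring_scope.

(** The defining property of a narrow operator is homogeneous: it persists for
    vectors [x], [y] of arbitrary norms, in the form that some [z] with the
    norm of [y] makes [`|x + z|] almost equal to [`|x| + `|y|] while [T] and a
    given functional barely distinguish [y] from [z]
    ([narrow_operator_anysphere]). The point is that if the triangle inequality
    is almost sharp for two unit vectors, it is almost sharp for all their
    nonnegative multiples ([ler_normD_conic]).

    Since the norm of an l1-sum is additive over the summands, this form can be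
    used separately in each of them: replacing each coordinate of [y] by the
    vector that it yields keeps the norm of [y], and the losses of the two
    coordinates add up. *)

(** If [t <= s], the combination is [s *: (u + v) - (s - t) *: v]: its first
    term has norm at least [s * (2 - d)] and its second one has norm [s - t], so
    that the defect [d] is multiplied by the larger coefficient only. *)
Lemma ler_normD_conic {R : realType} {V : normedModType R} {u v : V} {d : R}
    (s t : R) :
  `|u| = 1 -> `|v| = 1 -> 2 - d <= `|u + v| -> 0 <= s -> 0 <= t ->
  s + t - Num.max s t * d <= `|s *: u + t *: v|.
Proof.
wlog ts : u v s t / t <= s.
  move=> H u1 v1 uv s0 t0; have [ts|/ltW st] := leP t s.
    by have := H u v s t ts u1 v1 uv s0 t0; rewrite (max_idPl ts).
  have := H v u t s st v1 u1; rewrite (addrC v) => /(_ uv t0 s0).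
  by rewrite (max_idPl st) (addrC t) (addrC (t *: v)).
move=> u1 v1 uv s0 t0; rewrite (max_idPl ts).
have -> : s *: u + t *: v = s *: (u + v) - (s - t) *: v.
  by rewrite scalerDr scalerBl opprB addrA addrAC addrK.
apply: le_trans (lerB_dist _ _); rewrite !normrZ v1 mulr1.
rewrite (ger0_norm s0) ger0_norm ?subr_ge0//.
have := ler_wpM2l s0 uv; lra.
Qed.

Lemma bounded_linear_comp_isometry {R : realType} {U V W : normedModType R}
    {f : {linear V -> W}} {g : {linear U -> V}} :
  (forall x, `|g x| = `|x|) -> bounded_linear f ->
  bounded_linear (f \o g : {linear U -> W}).
Proof.
move=> gn /linear_boundedP f_bd; apply/linear_boundedP.
by apply: filterS f_bd => r fr x /=; rewrite -gn.
Qed.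

(** If [x] or [y] vanishes, [z := y] works. Otherwise the narrowness of [T] is
    applied to the normalized vectors and the result rescaled to the norm of
    [y]. *)
Lemma narrow_operator_anysphere {R : realType} {X Y : completeNormedModType R}
    {T : {linear X -> Y}} :
  narrow_operator T ->
  forall (x y : X) (xs : {linear X -> R^o}), bounded_linear xs ->
  forall e : R, 0 < e ->
  exists z : X, [/\ `|z| = `|y|, `|x| + `|y| - e <= `|x + z| &
    `|T (y - z)| + `|xs (y - z)| <= e].
Proof.
move=> [_ Tnarrow] x y xs xs_bd e e0.
have [->|x0] := eqVneq x 0.
  exists y; split=> //; first by rewrite normr0 !add0r gerBl ltW.
  by rewrite subrr !raddf0 !normr0 addr0 ltW.
have [->|y0] := eqVneq y 0.
  exists 0; split=> //; first by rewrite normr0 !addr0 gerBl ltW.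
  by rewrite subrr !raddf0 !normr0 addr0 ltW.
have nx0 : `|x| != 0 by rewrite normr_eq0.
have ny0 : `|y| != 0 by rewrite normr_eq0.
have unit_norm (v : X) : `|v| != 0 -> `| `|v|^-1 *: v| = 1.
  by move=> v0; rewrite normrZ normfV normr_id mulVf.
set m := Num.max `|x| `|y|.
have m0 : 0 < m by rewrite lt_max normr_gt0 x0.
(* Rescaling multiplies the errors by at most [m]. *)
have [z [z1 xz Tz]] := Tnarrow _ _ (unit_norm x nx0) (unit_norm y ny0) xs xs_bd
  (e / m) (divr_gt0 e0 m0).
exists (`|y| *: z); split.
- by rewrite normrZ normr_id z1 mulr1.
- have := ler_normD_conic `|x| `|y| (unit_norm x nx0) z1 xz.
  rewrite !normr_ge0 -/m mulrCA divff ?gt_eqF// mulr1 scalerA divff// scale1r.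
  exact.
- have -> : y - `|y| *: z = `|y| *: (`|y|^-1 *: y - z).
    by rewrite scalerBr scalerA divff// scale1r.
  rewrite !linearZ/= !normrZ normr_id -mulrDr.
  apply: (@le_trans _ _ (`|y| * (e / m))); first exact: ler_wpM2l.
  rewrite mulrCA ger_pMr// ler_pdivrMr// mul1r.
  by rewrite le_max lexx orbT.
Qed.

Theorem corollary4p2 (R : realType) (X1 X2 Y : completeNormedModType R)
    (T : {linear l1sum X1 X2 -> Y}) :
  bounded_linear T ->
  narrow_operator (T \o l1inl : {linear X1 -> Y}) ->
  narrow_operator (T \o l1inr : {linear X2 -> Y}) ->
  narrow_operator T.
Proof.
move=> T_bd T1 T2; split=> // x y x1 y1 xs xs_bd e e0.
have e20 : 0 < e / 2 by rewrite divr_gt0.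
have l1inl_norm (v : X1) : `|l1inl v : l1sum X1 X2| = `|v|.
  by rewrite l1sum_normE normr0 addr0.
have l1inr_norm (v : X2) : `|l1inr v : l1sum X1 X2| = `|v|.
  by rewrite l1sum_normE normr0 add0r.
have [z1 [nz1 xz1 Tz1]] := narrow_operator_anysphere T1 x.1 y.1 _
  (bounded_linear_comp_isometry l1inl_norm xs_bd) _ e20.
have [z2 [nz2 xz2 Tz2]] := narrow_operator_anysphere T2 x.2 y.2 _
  (bounded_linear_comp_isometry l1inr_norm xs_bd) _ e20.
exists ((z1, z2) : l1sum X1 X2); split.
- by rewrite l1sum_normE/= nz1 nz2 -l1sum_normE.
- move: x1 y1; rewrite !l1sum_normE /= => x1 y1; lra.
- have -> : y - (z1, z2) = l1inl (y.1 - z1) + l1inr (y.2 - z2).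
    by rewrite /l1inl /l1inr; congr pair; rewrite /= ?addr0 ?add0r.
  rewrite (linearD T) (linearD xs).
  apply: le_trans (lerD (ler_normD _ _) (ler_normD _ _)) _.
  by rewrite addrACA (splitr e); exact: lerD.
Qed.
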